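(* Let $m\ge 2$. The Laplacian matrix $L_m$ of the unicycle graph $\mathsf{UCYC}(K_m)$ of the complete graph $K_m$ (without self-loops) has eigenvalues in $\{0,1,\dots,m-1,m\}$, and for $i\in\{-1,0,1,\dots,m-1\}$ the (algebraic) multiplicity of $m-1-i$ as an eigenvalue of $L_m$ is $$\mathbf{m}_{L_m}(m-1-i)=\begin{cases} i\binom{m}{i+1}(m-1)^{m-i-2},&1\le i\le m-1,\\ m^{m-1}-(m-1)^{m-1},&i=-1,\\ m^{m-1}(m-2),&i=0,\end{cases}$$ where multiplicity $0$ means that the number is not an eigenvalue.
   Context: $K_m$ is the complete directed graph with vertex set $V=\{1,\dots,m\}$ and edge set $\{(i,j):i\neq j\}$. $\mathsf{U}_{K_m}$ is the set of pairs $(x,\rho)$ with $x\in V$ and $\rho:V\to V$, $\rho(v)\ne v$ for all $v$, such that the directed graph with edges $\{(v,\rho(v)):v\in V\}$ contains exactly one directed cycle and $x$ lies on it. The unicycle graph $\mathsf{UCYC}(K_m)$ is the directed graph with vertex set $\mathsf{U}_{K_m}$ and an edge $(x,\rho)\to(y,\eta)$ whenever $y\ne x$, $\eta(v)=\rho(v)$ for all $v\neq x$, and $\eta(x)=y$. Every vertex has out-degree $m-1$, and the uniform unicycle walk on $K_m$ is the simple random walk on this graph. $L_m$ is the matrix indexed by $\mathsf{U}_{K_m}\times\mathsf{U}_{K_m}$ with $L_m((x,\rho),(x,\rho))=m-1$, $L_m((x,\rho),(y,\eta))=-1$ if $(x,\rho)\to(y,\eta)$, and $0$ otherwise; i.e.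 $L_m=(m-1)I-A_m$ with $A_m$ the adjacency matrix. *)

(* Defs.v *)
From mathcomp Require Import all_boot all_order all_algebra.

Set Implicit Arguments.
Unset Strict Implicit.
Unset Printing Implicit Defensive.

Import GRing.Theory.

Local Open Scope ring_scope.

(* Directed cycles are identified with their edge sets, so that the starting  *)
(* point of an enumeration s of the cycle is irrelevant. As the vertices of s *)
(* are distinct, its length lies between 1 and #|T|.                          *)
Definition dicycles (T : finType) (e : rel T) : {set {set T * T}} :=
  [set c | [exists n : 'I_#|T|, exists s : n.+1.-tuple T,
     ucycleb e s && (c == [set (v, next s v) | v in s])]].

Definition on_dicycle (T : finType) (x : T) (c : {set T * T}) : bool :=
  [exists a in c, a.1 == x].

Notation unicycle_state m := ('I_m * {ffun 'I_m -> 'I_m})%type.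

(* frel r is the edge relation v -> r v.                                      *)
Definition unicycles (m : nat) : {set unicycle_state m} :=
  [set u : unicycle_state m | [forall v, u.2 v != v] &&
     [exists c, (dicycles (frel u.2) == [set c]) && on_dicycle u.1 c]].

Definition unicycle_edge (m : nat) : rel (unicycle_state m) :=
  fun u w => [&& w.1 != u.1,
                 [forall v, (v != u.1) ==> (w.2 v == u.2 v)]
               & w.2 u.1 == w.1].

Definition unicycle_laplacian (R : pzRingType) (m : nat) :
    'M[R]_#|unicycles m| :=
  \matrix_(a, b)
    (if a == b then (m.-1)%:R
     else if unicycle_edge (enum_val a) (enum_val b) then -1
     else 0).

Definition alg_mult (F : fieldType) (n : nat) (A : 'M[F]_n) (x : F) : nat :=
  mup x (char_poly A).

Lemma alg_mult_eq0 (F : fieldType) (n : nat) (A : 'M[F]_n) (x : F) :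
  (alg_mult A x == 0%N) = ~~ eigenvalue A x.
Proof.
rewrite eigenvalue_root_char /alg_mult.
have nz : char_poly A != 0 by rewrite monic_neq0 ?char_poly_monic.
by rewrite -dvdp_XsubCl XsubC_dvd // -eqn0Ngt.
Qed.

(* Main.v *)
Require Import Defs.
From mathcomp Require Import all_boot all_order all_algebra.
From mathcomp Require Import fingroup perm ring.

Set Implicit Arguments.
Unset Strict Implicit.
Unset Printing Implicit Defensive.

Import GRing.Theory Num.Theory.

Local Open Scope ring_scope.

(* A walk from (x, r) overwrites the rotor of every vertex it leaves, so a    *)
(* closed walk of K_m visiting exactly W lifts to as many closed walks of the *)
(* unicycle graph as there are forests rooted at W, i.e. f(W) =               *)
(* |W| m^(m-|W|-1) (a matrix-tree determinant). Since f(W) is the sum of      *)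
(* c(|U|) over U containing W, with c(j) = (j-1)(m-1)^(m-j-1), this gives     *)
(* tr A^k = \sum_U c(|U|) tr (A_U)^k for k > 0, where A_U is the adjacency    *)
(* matrix of the complete graph on U, with spectrum |U|-1 (once) and -1       *)
(* (|U|-1 times). Power sums determine the nonzero eigenvalues with their     *)
(* multiplicities; the multiplicity of 0 follows from the number of states.   *)

(** With L = (m-1)I - A, everything is read off from the traces tr A^k. A walk of K_m has one lift
    from each starting state over its first vertex; for a closed walk, the starts whose lift closes
    up number f(W), depending only on the size of the visited set W ([card_drive_fixed], via
    [card_forests]). [sum_clique_mult] spreads this weight over all U containing W, so for k > 0
    [trace_unicycle_adj_cliques] gives the trace of a formal combination of complete graphs, one for
    each U with weight c(|U|). The clique eigenvalue |U|-1 = i accounts for the generic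
    multiplicity, the eigenvalues -1 of all cliques together give m^(m-1) - (m-1)^(m-1), and the
    number of states ([card_unicycles]) fixes the eigenvalue 0. [eigenvalue_count] turns equality of
    power sums into equality of multiplicities. *)

Lemma trig_exp (R : comPzRingType) n (T : 'M[R]_n) k :
  is_trig_mx T ->
  is_trig_mx (T ^+ k) /\ forall i, (T ^+ k) i i = T i i ^+ k.
Proof.
move=> /is_trig_mxP Ttrig; elim: k => [|k [/is_trig_mxP IHt IHd]].
  split=> [|i]; last by rewrite mxE eqxx.
  by apply/is_trig_mxP=> i j lij; rewrite mxE -val_eqE /= ltn_eqF.
rewrite exprS; split=> [|i].
  apply/is_trig_mxP=> i j lij; rewrite mxE big1 // => l _.
  have [/Ttrig->|leli] := ltnP i l; first by rewrite mul0r.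
  by rewrite IHt ?mulr0 // (leq_ltn_trans leli).
rewrite mxE (bigD1 i) //= IHd big1 ?addr0 ?exprS // => l neli.
case: (ltngtP i l) => [/Ttrig->|/IHt->|eil]; rewrite ?mul0r ?mulr0 //.
by rewrite -val_eqE /= eil eqxx in neli.
Qed.

Lemma similar_char_poly (F : fieldType) n (P A : 'M[F]_n) :
  P \in unitmx -> char_poly (invmx P *m A *m P) = char_poly A.
Proof.
move=> Pu; rewrite /char_poly /char_poly_mx !map_mxM.
set Q := map_mx _ (invmx P); set P' := map_mx _ P.
have QP : Q *m P' = 1%:M by rewrite -map_mxM mulVmx // map_mx1.
set A' := map_mx _ A.
have -> : 'X%:M - Q *m A' *m P' = Q *m ('X%:M - A') *m P'.
  by rewrite mulmxBr mulmxBl mul_mx_scalar -scalemxAl QP scalemx1.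
by rewrite !det_mulmx mulrC mulrA -det_mulmx (mulmx1C QP) det1 mul1r.
Qed.

(** By Schur triangularization, [d] is the diagonal of a triangular matrix similar to A. The shift
    by [c] is there for the Laplacian. *)
Lemma spectrum_mx (C : numClosedFieldType) n (A : 'M[C]_n) :
  exists d : 'I_n -> C,
    (forall k, \tr (A ^+ k) = \sum_i d i ^+ k) /\
    (forall c x, mup x (char_poly (c%:M - A)) = #|[pred i | c - d i == x]|).
Proof.
case: n A => [|n] A.
  exists (fun=> 0); split=> [k|c x].
    by rewrite big_ord0 /mxtrace big_ord0.
  rewrite eq_card0 => [|[] //]; rewrite [char_poly _]det_mx00.
  by rewrite mupNroot // root1.
have [P /unitarymx_unit Pu Ttrig] := Schur A (ltn0Sn n).
rewrite /similar_to /= conjumx // in Ttrig; set T := P *m A *m _ in Ttrig.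
have AE : A = invmx P *m T *m P by rewrite /T !mulmxA mulVmx // mul1mx mulmxKV.
clearbody T; have AkE k : A ^+ k = invmx P *m T ^+ k *m P.
  elim: k => [|k IH]; first by rewrite !expr0 mulmx1 mulVmx.
  by rewrite !exprS IH {1}AE -!mulmxE !mulmxA mulmxK.
exists (fun i => T i i); split=> [k|c x].
  rewrite AkE mxtrace_mulC mulmxA mulmxV // mul1mx.
  by apply: eq_bigr => i _; rewrite (trig_exp k Ttrig).2.
have -> : c%:M - A = invmx P *m (c%:M - T) *m P.
  by rewrite mulmxBr mulmxBl mul_mx_scalar -scalemxAl mulVmx // scalemx1 -AE.
rewrite similar_char_poly // char_poly_trig; last first.
  apply/is_trig_mxP=> i j lij; rewrite !mxE (is_trig_mxP Ttrig) //.
  by rewrite -val_eqE /= ltn_eqF // mulr0n subr0.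
rewrite -(big_map (fun i => (c%:M - T) i i) xpredT (fun z => 'X - z%:P)) /=.
rewrite mu_prod_XsubC count_map cardE size_filter; apply/eq_count=> i /=.
by rewrite !mxE eqxx.
Qed.

(** Lagrange interpolation; applied to eigenvalues, it turns power sums into multiplicities. *)
Lemma interpolate_indicator (F : fieldType) (s : seq F) (z : F) :
  exists p : {poly F}, forall y, y \in s -> p.[y] = (y == z)%:R.
Proof.
pose q : {poly F} := \prod_(y <- s | y != z) ('X - y%:P).
have qz : q.[z] != 0.
  rewrite horner_prod prodf_seq_neq0; apply/allP=> y _; apply/implyP=> nyz.
  by rewrite hornerXsubC subr_eq0 eq_sym.
exists ((q.[z])^-1 *: q) => y ys; rewrite hornerZ.
case: eqP => [->|/eqP nyz]; first by rewrite mulVf.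
by rewrite [q.[y]]horner_prod (big_rem y) //= nyz hornerXsubC subrr mul0r mulr0.
Qed.

Lemma det_rank_one (R : comPzRingType) n (u : 'cV[R]_n) (v : 'rV[R]_n) :
  \det (1%:M - u *m v) = 1 - (v *m u) 0 0.
Proof.
have E1 : block_mx 1%:M v u 1%:M = block_mx 1%:M 0 u 1%:M *m
    block_mx 1%:M v 0 (1%:M - u *m v).
  by rewrite mulmx_block !mul1mx !mulmx1 !mul0mx ?mulmx0 !addr0
    [_ + (_ - _)]addrC subrK.
have E2 : block_mx 1%:M v u 1%:M = block_mx 1%:M v 0 1%:M *m
    block_mx (1%:M - v *m u) 0 u 1%:M.
  by rewrite mulmx_block !mul1mx !mulmx1 !mul0mx !add0r subrK.
move: (congr1 determinant E1); rewrite E2 !det_mulmx !det_ublock !det_lblock.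
by rewrite !det1 !mul1r !mulr1 => <-; rewrite det_mx11 !mxE eqxx.
Qed.

(** * Functional graphs and the count of rooted forests *)

Definition reaches (T : finType) (f : T -> T) (W : {set T}) (v : T) : bool :=
  [exists w in W, fconnect f v w].

Lemma reachesE (T : finType) (f : T -> T) (W : {set T}) v :
  reaches f W v = (v \in W) || reaches f W (f v).
Proof.
apply/exists_inP/orP => [[w wW]|[vW|/exists_inP[w wW fw]]].
- rewrite fconnect_eqVf => /orP[/eqP->|fw]; [by left | right].
  by apply/exists_inP; exists w.
- by exists v.
by exists w => //; apply: connect_trans (fconnect1 f v) fw.
Qed.

Lemma not_reaches_invariant (T : finType) (f : T -> T) (W S : {set T}) v :
  [disjoint S & W] -> {in S, forall u, f u \in S} -> v \in S ->
  ~~ reaches f W v.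
Proof.
move=> dSW fS vS; apply/exists_inP=> -[w wW /iter_findex fw].
suff wS : w \in S by rewrite (disjointFr dSW wS) in wW.
by rewrite -fw; elim: (findex f v w) => //= k; apply: fS.
Qed.

(* I - P_f (rows in W replaced by those of I): if f leads every vertex to W,  *)
(* only the identity permutation contributes to the determinant; otherwise    *)
(* the indicator of the vertices not leading to W lies in the kernel.         *)
Lemma det_functional (R : idomainType) m (W : {set 'I_m})
    (f : {ffun 'I_m -> 'I_m}) :
  \det (\matrix_(v, z) ((v == z)%:R - ((v \notin W) && (f v == z))%:R) : 'M[R]_m)
    = [forall v, reaches f W v]%:R.
Proof.
set M := \matrix_(v, z) _.
case: forallP => [allW|/forallP]; last first.
  rewrite negb_forall => /existsP[v nv]; apply/eqP; rewrite -det_tr.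
  apply/det0P; exists (\row_u (~~ reaches f W u)%:R).
    by apply: contraNneq (oner_neq0 R) => /rowP/(_ v); rewrite !mxE nv => /eqP.
  apply/rowP=> u; rewrite !mxE.
  under eq_bigr => z _ do rewrite !mxE mulrBr.
  rewrite sumrB (bigD1 u) //= eqxx mulr1 big1 ?addr0; last first.
    by move=> z /negPf; rewrite eq_sym => ->; rewrite mulr0.
  rewrite (bigD1 (f u)) //= eqxx big1 ?addr0 ?andbT; last first.
    by move=> z /negPf; rewrite eq_sym => ->; rewrite andbF mulr0.
  by rewrite reachesE; case: (u \in W); rewrite /= ?mulr0 ?mulr1 ?subrr.
rewrite /determinant (bigD1 1%g) //= [X in _ + X]big1 ?addr0.
  rewrite odd_perm1 mul1r big1 // => v _; rewrite perm1 mxE eqxx.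
  case: andP => [[nWv /eqP fv]|]; last by rewrite subr0.
  suff /negP[] : ~~ reaches f W v by apply: allW.
  apply: (@not_reaches_invariant _ _ _ [set v]); rewrite ?disjoints1 ?set11 //.
  by move=> u /set1P->; rewrite fv set11.
(* If no factor of the term of [s] vanishes, then f agrees with s on the support of s, which avoids
   W and is stable under f; its vertices would never reach W. *)
move=> s ns1; case: (pickP (fun v => M v (s v) == 0)) => [v /eqP Mv|nzM].
  by rewrite (bigD1 v) //= Mv mul0r mulr0.
case/eqP: ns1; apply/permP=> v; rewrite perm1; apply/eqP.
apply: contraT => sv; suff /negP[] : ~~ reaches f W v by apply: allW.
have nS u : s u != u -> (u \notin W) /\ f u = s u.
  move=> su; move: (nzM u); rewrite mxE [u == _]eq_sym (negPf su) sub0r oppr_eq0.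
  by case: (u \in W); case: (f u =P s u) => //= _; rewrite eqxx.
apply: (@not_reaches_invariant _ _ _ [set u | s u != u]).
- apply/pred0P=> u /=; rewrite inE; case: eqP => //= /eqP /nS[].
  by move/negPf.
- by move=> u; rewrite !inE => su; rewrite (nS u su).2 (inj_eq perm_inj).
by rewrite inE.
Qed.

(** [Q] constrains the rotors of the roots only: it freezes them in [card_drive_fixed] and forbids a
    loop at the root in [card_unicycles]. *)
Definition forests m (W : {set 'I_m}) (Q : 'I_m -> pred 'I_m) :
    {pred {ffun 'I_m -> 'I_m}} :=
  [pred f : {ffun 'I_m -> 'I_m} |
     [forall v in W, Q v (f v)] && [forall v, reaches f W v]].

(* Expanding by multilinearity the determinant of the matrix with row v equal *)
(* to m e_v - (1, ..., 1) for v outside W and to |Q v| e_v for v in W gives   *)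
(* the sum of the determinants of det_functional over all rotor choices.      *)
Lemma card_forests (F : numFieldType) m (W : {set 'I_m}) (Q : 'I_m -> pred 'I_m) :
  (0 < m)%N ->
  #|forests W Q|%:R =
    (\prod_(v in W) #|Q v|%:R) * (#|W|%:R * m%:R ^+ (m - #|W|) / m%:R) :> F.
Proof.
move=> m_gt0; have m0 : m%:R != 0 :> F by rewrite pnatr_eq0 -lt0n.
pose Q' v y := (v \in W) ==> Q v y.
have -> : #|forests W Q|%:R = \sum_(f in family Q')
    \det (\matrix_(v, z) ((v == z)%:R - ((v \notin W) && (f v == z))%:R)
            : 'M[F]_m).
  under eq_bigr => f _ do rewrite det_functional.
  rewrite -natr_sum -sum1_card; congr _%:R.
  transitivity (\sum_(f in family Q' | [forall v, reaches f W v]) 1)%N.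
    apply: eq_bigl => f; rewrite !inE /=; congr (_ && _).
  by rewrite big_mkcondr; apply: eq_bigr => f _; case: ifP.
transitivity (\det (diag_mx (\row_v (if v \in W then #|Q v|%:R else m%:R)) *m
   (1%:M - (\col_v ((v \notin W)%:R / m%:R)) *m const_mx 1) : 'M[F]_m)).
  set M := _ *m _.
  have ME v z : M v z = \sum_(y | Q' v y)
      ((v == z)%:R - ((v \notin W) && (y == z))%:R).
    rewrite /M mul_diag_mx !mxE big_ord1 !mxE mulr1 sumrB sumr_const /Q'.
    case: (boolP (v \in W)) => /= vW.
      by rewrite mul0r subr0 big1 // !subr0 mulr_natl.
    rewrite (bigD1 z) //= eqxx big1 ?addr0; last by move=> y /negPf->.
    by rewrite card_ord mul1r mulrBr divff // mulr_natl.
  rewrite /determinant exchange_big /=; apply: eq_bigr => s _.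
  rewrite -mulr_sumr; congr (_ * _).
  under [RHS]eq_bigr => v _ do rewrite ME.
  rewrite bigA_distr_big_dep; apply: eq_bigr => f _.
  by apply: eq_bigr => v _; rewrite mxE.
(* The rank-one factor contributes 1 - (m - |W|)/m = |W|/m. *)
rewrite det_mulmx det_diag det_rank_one mxE.
under eq_bigr do rewrite mxE.
rewrite (bigID (mem W)) /= -[LHS]mulrA; congr (_ * _).
  by apply: eq_bigr => v ->.
rewrite (eq_bigr (fun=> m%:R)) => [|v /negPf -> //].
rewrite [X in 1 - X](eq_bigr (fun j => (j \notin W)%:R / m%:R)) => [|j _];
  last by rewrite !mxE mul1r.
rewrite -mulr_suml -natr_sum.
have cW : (#|W| + #|~: W| = m)%N by rewrite cardsC card_ord.
have -> : (\sum_i (i \notin W) = #|~: W|)%N.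
  by rewrite -sum1_card -big_mkcond; apply: eq_bigl => i; rewrite inE.
rewrite prodr_const (_ : #|_| = #|~: W|); last first.
  by apply: eq_card => v; rewrite !inE.
have -> : (m - #|W| = #|~: W|)%N.
  apply/eqP; rewrite -(eqn_add2l #|W|) cW subnKC //.
  by rewrite -[X in (_ <= X)%N]card_ord max_card.
have -> : #|W|%:R = m%:R - #|~: W|%:R :> F.
  by apply/eqP; rewrite eq_sym subr_eq -natrD cW.
by field.
Qed.

(** * Unicycles as rotor configurations leading to the walker *)

Lemma dicycle_orbit (T : finType) (r : {ffun T -> T}) x :
  fconnect r (r x) x ->
  [set (v, r v) | v in fconnect r x] \in dicycles (frel r).
Proof.
move=> rx; rewrite inE; have cyc : fcycle r (orbit r x) by rewrite -fconnect_f.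
have lt_o : ((fingraph.order r x).-1 < #|T|)%N by rewrite orderSpred max_card.
apply/existsP; exists (Ordinal lt_o) => /=.
have sz : size (orbit r x) == (fingraph.order r x).-1.+1
  by rewrite size_orbit orderSpred.
apply/existsP; exists (Tuple sz); rewrite /ucycleb /= cyc orbit_uniq /=.
apply/eqP/setP=> -[a b]; apply/imsetP/imsetP => -[v vx -> {a b}].
  have vo : v \in orbit r x by rewrite -fconnect_orbit.
  by exists v => //; rewrite (eqP (next_cycle cyc vo)).
exists v; first by rewrite [_ \in _]fconnect_orbit.
by rewrite (eqP (next_cycle cyc vx)).
Qed.

Lemma mem_dicycles (T : finType) (r : {ffun T -> T}) c :
  c \in dicycles (frel r) ->
  exists2 x, fconnect r (r x) x & c = [set (v, r v) | v in fconnect r x].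
Proof.
rewrite inE => /existsP[n /existsP[s /andP[/andP[cyc us] /eqP->]]].
have xs : thead s \in (s : seq T) by rewrite mem_tnth.
exists (thead s).
  rewrite (fconnect_cycle cyc) //.
  by rewrite (eqP (next_cycle cyc xs)) mem_next.
apply/setP=> -[a b]; apply/imsetP/imsetP => -[v vx -> {a b}].
  exists v; first by rewrite [_ \in _](fconnect_cycle cyc xs).
  by rewrite (eqP (next_cycle cyc vx)).
have vs : v \in (s : seq T) by rewrite -(fconnect_cycle cyc xs).
by exists v => //; rewrite (eqP (next_cycle cyc vs)).
Qed.

Lemma reaches_dicycle (T : finType) (r : {ffun T -> T}) v :
  exists2 w, fconnect r v w & fconnect r (r w) w.
Proof.
have /trajectP[j lt_j E] := looping_order r v.
exists (iter j r v); first exact: fconnect_iter.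
have {2}-> : iter j r v =
    iter (fingraph.order r v - j.+1) r (r (iter j r v)) :> T.
  by rewrite -iterS -iterD subnK.
exact: fconnect_iter.
Qed.

(** Every vertex of a functional graph runs into a dicycle, and dicycles are the orbits of periodic
    points; so the dicycle through x is the only one exactly when every vertex leads to x. *)
Lemma in_unicycles m x (r : {ffun 'I_m -> 'I_m}) :
  ((x, r) \in unicycles m) =
    [forall v, r v != v] && [forall v, fconnect r v x].
Proof.
rewrite inE /=; congr (_ && _); apply/existsP/forallP => /=.
  move=> [c /andP[/eqP dc /exists_inP[[a b] abc /eqP/= ax]]] v.
  have [w vw ww] := reaches_dicycle r v; apply: connect_trans vw _.
  move: abc (dicycle_orbit ww); rewrite dc => abc /set1P cE.
  by move: abc; rewrite -cE => /imsetP[u wu [au _]]; rewrite -ax au.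
move=> allx; have := dicycle_orbit (allx (r x)).
set c := imset _ _ => dc; exists c; apply/andP; split; last first.
  by apply/exists_inP; exists (x, r x) => //; apply/imsetP; exists x; rewrite ?inE.
apply/eqP/setP=> c'; rewrite inE; apply/idP/eqP=> [/mem_dicycles[w ww ->]|-> //].
have cyc : fcycle r (orbit r w) by rewrite -fconnect_f.
have xw : x \in orbit r w by rewrite -fconnect_orbit allx.
have E u : fconnect r w u = fconnect r x u.
  by rewrite !(fconnect_cycle cyc) ?in_orbit.
by apply/setP=> a; apply/imsetP/imsetP => -[u uw ->]; exists u => //;
  move: uw; rewrite /in_mem /= E.
Qed.

(** * Driving the rotors along a walk *)

Definition set_rotor (T : finType) (r : {ffun T -> T}) x y : {ffun T -> T} :=
  [ffun v => if v == x then y else r v].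

(* The final rotor configuration; the walker ends at last x s.                *)
Fixpoint drive (T : finType) (x : T) (r : {ffun T -> T}) (s : seq T) :
    {ffun T -> T} :=
  if s is y :: s' then drive y (set_rotor r x y) s' else r.

Lemma drive_out (T : finType) (x : T) (r : {ffun T -> T}) s v :
  v \notin x :: s -> drive x r s v = r v.
Proof.
elim: s x r => //= y s IHs x r; rewrite inE => /norP[nvx nvs].
by rewrite IHs // ffunE (negPf nvx).
Qed.

(** [belast x s] lists the vertices that the walker leaves, and the last exit from v decides its
    final rotor. *)
Lemma drive_in (T : finType) (x : T) (r r' : {ffun T -> T}) s v :
  v \in belast x s -> drive x r s v = drive x r' s v.
Proof.
suff: forall r1 r2 : {ffun T -> T},
    (v \in belast x s) || (r1 v == r2 v) ->
    drive x r1 s v = drive x r2 s v.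
  by move=> H vs; apply: H; rewrite vs.
elim: s x {r r'} => [x r1 r2 /eqP //|y s IHs x r1 r2 /= H]; apply: IHs; move: H.
by rewrite !ffunE inE; case: (v == x); rewrite ?eqxx ?orbT.
Qed.

Lemma drive_neq (T : finType) (x : T) (r : {ffun T -> T}) s v :
  path (fun a b => b != a) x s -> (v \in belast x s) || (r v != v) ->
  drive x r s v != v.
Proof.
elim: s x r => [//|y s IHs] x r /= /andP[nyx ps] H; apply: IHs => //.
move: H; rewrite ffunE inE; case: eqP => [->|] //=.
by rewrite nyx orbT.
Qed.

(** The path from v is unchanged up to its first visit to x, where the new rotor leads to y. *)
Lemma set_rotor_connect (T : finType) (r : {ffun T -> T}) x y v :
  fconnect r v x -> fconnect (set_rotor r x y) v y.
Proof.
have xy : fconnect (set_rotor r x y) x y.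
  by apply: connect1; rewrite /= ffunE eqxx.
move=> /iter_findex; move: (findex r v x) => k.
elim: k v => [v /= ->|k IHk v] //.
rewrite iterSr; have [->|nvx /IHk] := eqVneq v x; first by [].
by apply: connect_trans; apply: connect1; rewrite /= ffunE (negPf nvx).
Qed.

Lemma drive_connect (T : finType) (x : T) (r : {ffun T -> T}) s v :
  (v \in s) || fconnect r v x -> fconnect (drive x r s) v (last x s).
Proof.
elim: s x r => [//|y s IHs] x r H; apply: IHs => /=; move: H; rewrite inE.
case: eqP => [->|_] /=; first by rewrite connect0 orbT.
by case: (v \in s) => //= /set_rotor_connect.
Qed.

(** A closed walk leaves every vertex it visits, so the last exits force the rotors on the visited
    set; the other rotors need only lead into that set. *)
Lemma card_drive_fixed (F : numFieldType) m (x : 'I_m) (s : seq 'I_m) :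
  path (fun a b => b != a) x s -> last x s = x -> (0 < size s)%N ->
  #|[pred r | ((x, r) \in unicycles m) && (drive x r s == r)]|%:R =
    (#|[set v in s]|%:R * m%:R ^+ (m - #|[set v in s]|) / m%:R) :> F.
Proof.
move=> ps ls s_gt0; set W := [set v in s].
(* The identity is an arbitrary start: by [drive_in], the values of [e] on the visited set do not
   depend on it. *)
pose e := drive x [ffun v => v] s.
have xs : x \in s by case: (s) s_gt0 ls => // y s' _ /= <-; apply: mem_last.
have bs v : v \in s -> v \in belast x s.
  move=> vs; have : v \in x :: s by rewrite inE vs orbT.
  rewrite lastI ls mem_rcons inE => /predU1P[->|//].
  by case: (s) s_gt0 => //= y s' _; rewrite mem_head.
have sx v : (v \in x :: s) = (v \in s).
  by rewrite inE; case: eqP => // ->.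
rewrite -[RHS]mul1r (_ : #|_| = #|forests W (fun v => pred1 (e v))|); last first.
  apply: eq_card => r; rewrite -!topredE /= in_unicycles; apply/idP/idP.
    move=> /andP[/andP[_ /forallP allx] /eqP fixr]; apply/andP; split.
      apply/forall_inP=> v; rewrite inE => /bs vs.
      by rewrite /= /e -(drive_in r _ vs) fixr.
    by apply/forallP=> v; apply/exists_inP; exists x; rewrite ?inE.
  move=> /andP[/forall_inP rW /forallP allW].
  have fixr : drive x r s = r.
    apply/ffunP=> v; have [vs|nvs] := boolP (v \in s).
      rewrite (drive_in _ [ffun v => v] (bs v vs)).
      by apply/esym/eqP/rW; rewrite inE.
    by rewrite drive_out ?sx.
  rewrite fixr eqxx andbT; apply/andP; split; apply/forallP=> v.
    have [vs|nvs] := boolP (v \in s).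
      by rewrite -{1}fixr drive_neq ?bs.
    apply: contraTneq (allW v) => rv.
    apply: (@not_reaches_invariant _ _ _ [set v]); rewrite ?disjoints1 ?inE //.
    by move=> u /set1P->; rewrite rv set11.
  have /exists_inP[w] := allW v; rewrite inE => ws vw; apply: connect_trans vw _.
  by rewrite -{1}fixr -{2}ls drive_connect ?ws.
rewrite card_forests ?(leq_ltn_trans _ (ltn_ord x)) //; congr (_ * _).
by rewrite big1 // => v _; rewrite card1.
Qed.

(** A state at x is a forest rooted at x with one of m-1 rotors at the root; a fixed point elsewhere
    could not reach x. *)
Lemma card_unicycles (F : numFieldType) m : (0 < m)%N ->
  #|unicycles m|%:R = m%:R ^+ m.-1 * (m%:R - 1) :> F.
Proof.
move=> m_gt0; have m0 : m%:R != 0 :> F by rewrite pnatr_eq0 -lt0n.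
transitivity (\sum_(x : 'I_m) #|forests [set x] (fun v => predC1 v)|%:R : F).
  rewrite -natr_sum; congr _%:R.
  rewrite -sum1_card big_mkcond.
  transitivity (\sum_p (if (p.1, p.2) \in unicycles m then 1 else 0))%N.
    by apply: eq_bigr => -[].
  rewrite -(pair_bigA _ (fun x r => if (x, r) \in unicycles m then 1 else 0)%N).
  apply: eq_bigr => x _; rewrite -big_mkcond -sum1_card; apply: eq_bigl => r.
  rewrite in_unicycles -topredE /=; apply/andP/andP.
    case=> /forallP nfix /forallP allx; split.
      by apply/forall_inP=> v _; apply: nfix.
    by apply/forallP=> v; apply/exists_inP; exists x; rewrite ?set11.
  case=> /forall_inP nx /forallP allx; split; apply/forallP=> v; last first.
    by have /exists_inP[w /set1P->] := allx v.
  have [vx|nvx] := boolP (v \in [set x]); first exact: nx.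
  apply: contraTneq (allx v) => rv.
  apply: (@not_reaches_invariant _ _ _ [set v]); rewrite ?disjoints1 ?set11 //.
  by move=> u /set1P->; rewrite rv set11.
under eq_bigr => x _.
  rewrite card_forests // big_set1 cards1 cardC1 card_ord mul1r subn1.
  over.
case: m m_gt0 m0 => // k _ m0.
rewrite sumr_const card_ord /= -[LHS]mulr_natl; have -> : k.+1%:R - 1 = k%:R :> F.
  by rewrite -addn1 natrD addrK.
by rewrite mulrCA [X in _ * X]mulrC divfK // mulrC.
Qed.

(** * Powers of the adjacency matrix as sums over lifted walks *)

Fixpoint words (T : finType) k : seq (seq T) :=
  if k is k'.+1 then [seq y :: s | y <- enum T, s <- words T k'] else [:: [::]].

Lemma big_words (R : nmodType) (T : finType) k (P : pred (seq T)) (G : seq T -> R) :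
  \sum_(s <- words T k.+1 | P s) G s =
    \sum_y \sum_(s <- words T k | P (y :: s)) G (y :: s).
Proof.
rewrite big_mkcond big_allpairs_dep big_enum /=.
by apply: eq_bigr => y _; rewrite -big_mkcond.
Qed.

Lemma size_words (T : finType) k s : s \in words T k -> size s = k.
Proof.
elim: k s => [|k IHk] s; first by rewrite inE => /eqP->.
by case/allpairsP=> -[y t] /= [_ /IHk<- ->].
Qed.

Local Notation neqpath := (path (fun a b => b != a)).

Definition unicycle_adj (R : pzRingType) m : 'M[R]_#|unicycles m| :=
  \matrix_(a, b) (unicycle_edge (enum_val a) (enum_val b))%:R.

Lemma unicycle_laplacianE (R : pzRingType) m :
  unicycle_laplacian R m = (m.-1%:R)%:M - unicycle_adj R m.
Proof.
apply/matrixP=> a b; rewrite !mxE; have [->|nab] := eqVneq a b.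
  by rewrite /unicycle_edge eqxx mulr1n subr0.
by case: unicycle_edge; rewrite mulr0n sub0r ?oppr0.
Qed.

Lemma set_rotor_unicycle m x y (r : {ffun 'I_m -> 'I_m}) :
  (x, r) \in unicycles m -> y != x -> (y, set_rotor r x y) \in unicycles m.
Proof.
rewrite !in_unicycles => /andP[/forallP nfix /forallP allx] nyx.
apply/andP; split; apply/forallP=> v; last exact: set_rotor_connect.
by rewrite ffunE; case: (v =P x) => [->|_].
Qed.

Lemma sum_unicycle_edge (R : nmodType) m (x : 'I_m) (r : {ffun 'I_m -> 'I_m})
    (G : unicycle_state m -> R) :
  (x, r) \in unicycles m ->
  \sum_(u in unicycles m | unicycle_edge (x, r) u) G u =
    \sum_(y | y != x) G (y, set_rotor r x y).
Proof.
move=> xr; rewrite (reindex_onto (fun y => (y, set_rotor r x y)) fst) /=.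
  apply: eq_bigl => y; rewrite eqxx andbT /unicycle_edge /= ffunE eqxx eqxx andbT.
  have [->|nyx] := eqVneq y x; first by rewrite andbF.
  rewrite set_rotor_unicycle //=; apply/forall_inP=> v nvx.
  by rewrite ffunE (negPf nvx).
move=> [y r'] /andP[_ /and3P[/= _ /forall_inP rr' /eqP ry]].
congr (_, _); apply/ffunP=> v; rewrite ffunE.
by case: eqP => [->|/eqP /rr' /eqP].
Qed.

(** Each walk of K_m from x has exactly one lift from (x, r), whose end is given by [drive]. *)
Lemma unicycle_adj_exp (R : pzRingType) m k x r (a b : 'I_#|unicycles m|) :
  enum_val a = (x, r) ->
  (unicycle_adj R m ^+ k) a b =
    \sum_(s <- words 'I_m k | neqpath x s)
      (enum_val b == (last x s, drive x r s))%:R.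
Proof.
elim: k x r a => [|k IHk] x r a ea.
  by rewrite expr0 big_cons big_nil addr0 mxE /= -ea (inj_eq enum_val_inj) eq_sym.
pose G (u : unicycle_state m) : R := \sum_(s <- words 'I_m k | neqpath u.1 s)
   (enum_val b == (last u.1 s, drive u.1 u.2 s))%:R.
have -> : (unicycle_adj R m ^+ k.+1) a b =
    \sum_(c < #|unicycles m|)
      (if unicycle_edge (x, r) (enum_val c) then G (enum_val c) else 0).
  rewrite exprS mxE; apply: eq_bigr => c _; rewrite mxE ea.
  rewrite (IHk (enum_val c).1 (enum_val c).2); last by case: (enum_val c).
  by case: ifP; rewrite ?mul1r ?mul0r.
rewrite -(big_enum_val (A := mem (unicycles m))
  (fun u => if unicycle_edge (x, r) u then G u else 0)).
rewrite -big_mkcondr sum_unicycle_edge; last by rewrite -ea enum_valP.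
rewrite big_words big_mkcond; apply: eq_bigr => y _ /=.
by case: ifP => //= _; rewrite big_pred0.
Qed.

Lemma trace_unicycle_adj (R : pzRingType) m k :
  \tr (unicycle_adj R m ^+ k) =
    \sum_x \sum_(s <- words 'I_m k | neqpath x s && (last x s == x))
      #|[pred r | ((x, r) \in unicycles m) && (drive x r s == r)]|%:R.
Proof.
pose H (x : 'I_m) (r : {ffun 'I_m -> 'I_m}) : R :=
  \sum_(s <- words 'I_m k | neqpath x s) ((x, r) == (last x s, drive x r s))%:R.
transitivity (\sum_(u in unicycles m) H u.1 u.2).
  rewrite big_enum_val; apply: eq_bigr => a _.
  rewrite (@unicycle_adj_exp _ _ _ (enum_val a).1 (enum_val a).2); last first.
    by case: (enum_val a).
  by rewrite /H; case: (enum_val a).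
rewrite big_mkcond.
transitivity (\sum_x \sum_r (if (x, r) \in unicycles m then H x r else 0)).
  by rewrite pair_bigA; apply: eq_bigr => -[].
apply: eq_bigr => x _; rewrite -big_mkcond exchange_big /= big_mkcondr.
apply: eq_bigr => s _; case: eqP => [lx|nlx].
  rewrite -sum1_card natr_sum big_mkcondr; apply: eq_bigr => r _.
  by rewrite lx xpair_eqE eqxx eq_sym; case: eqP.
by rewrite big1 // => r _; rewrite xpair_eqE; case: eqP => // /esym.
Qed.

(** * Binomial moments and sums over supersets *)

Lemma sum_supersets (R : pzRingType) (T : finType) (W : {set T}) (G : nat -> R) :
  \sum_(U : {set T} | W \subset U) G #|U| =
    \sum_(j < #|~: W|.+1) 'C(#|~: W|, j)%:R * G (#|W| + j)%N.
Proof.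
rewrite (reindex_onto (fun J => W :|: J) (fun U => U :\: W)); last first.
  by move=> U sWU; rewrite setDE setUIr setUCr setIT; apply/setUidPr.
rewrite (eq_bigl (fun J : {set T} => J \subset ~: W)); last first.
  move=> J; rewrite subsetUl /= setDUl setDv set0U setDE.
  by apply/eqP/idP=> [<-|/setIidPl //]; rewrite subsetIr.
rewrite (partition_big (fun J : {set T} => inord #|J| : 'I_#|~: W|.+1) xpredT) //=.
apply: eq_bigr => j _.
rewrite -cards_draws -[X in X%:R]sum1_card natr_sum mulr_suml.
apply: eq_big => [J|J /andP[sJ /eqP <-]].
  rewrite inE; have [sJ /=|//] := boolP (J \subset _).
  by rewrite -val_eqE /= inordK // ltnS subset_leq_card.
rewrite mul1r inordK ?ltnS ?subset_leq_card // cardsU (_ : W :&: J = set0).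
  by rewrite cards0 subn0.
by apply/eqP; rewrite setI_eq0 disjoint_sym -[W]setCK -subsets_disjoint.
Qed.

Lemma sum_bin_shift (R : pzRingType) N (G : nat -> R) :
  \sum_(j < N.+2) 'C(N.+1, j)%:R * (j%:R * G j) =
    N.+1%:R * \sum_(j < N.+1) 'C(N, j)%:R * G j.+1.
Proof.
rewrite big_ord_recl mul0r mulr0 add0r mulr_sumr; apply: eq_bigr => j _.
by rewrite !mulrA -!natrM mulnC -mul_bin_diag.
Qed.

Lemma sum_bin (R : comPzRingType) N (a : R) :
  \sum_(j < N.+1) 'C(N, j)%:R * a ^+ (N - j) = (a + 1) ^+ N.
Proof.
by rewrite exprDn; apply: eq_bigr => j _; rewrite expr1n mulr1 mulr_natl.
Qed.

Lemma sum_bin_mom1 (R : comPzRingType) N (a : R) :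
  \sum_(j < N.+1) 'C(N, j)%:R * (j%:R * a ^+ (N - j)) = N%:R * (a + 1) ^+ N.-1.
Proof.
case: N => [|N]; first by rewrite big_ord1 !mul0r mulr0.
by rewrite (sum_bin_shift _ (fun j => a ^+ (N.+1 - j))) -sum_bin.
Qed.

Lemma sum_bin_mom2 (R : comPzRingType) N (a : R) :
  \sum_(j < N.+2) 'C(N.+1, j)%:R * (j%:R * ((j%:R - 1) * a ^+ (N.+1 - j))) =
    N.+1%:R * (N%:R * (a + 1) ^+ N.-1).
Proof.
rewrite (sum_bin_shift _ (fun j => (j%:R - 1) * a ^+ (N.+1 - j))) -sum_bin_mom1.
congr (_ * _); apply: eq_bigr => j _.
by rewrite -natr1 addrK subSS.
Qed.

(* (j - 1) (m - 1)^(m - j - 1), written so that it is also correct for j = m. *)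
Definition clique_mult (F : fieldType) m j : F :=
  (j%:R - 1) * (m%:R - 1) ^+ (m - j) / (m%:R - 1).

(** Inversion of f over supersets. With w = |W| and N = m - w, the moments of j give ((w-1) m^N + N
    m^(N-1))/(m-1), which is w m^(N-1). *)
Lemma sum_clique_mult (F : numFieldType) m (W : {set 'I_m}) : (2 <= m)%N ->
  \sum_(U : {set 'I_m} | W \subset U) clique_mult F m #|U| =
    #|W|%:R * m%:R ^+ (m - #|W|) / m%:R.
Proof.
move=> m_ge2; rewrite sum_supersets.
have cW : (#|W| + #|~: W| = m)%N by rewrite cardsC card_ord.
move: cW; move: #|W| #|~: W| => w N cW.
have m0 : m%:R != 0 :> F by rewrite pnatr_eq0 -lt0n ltnW.
have a0 : m%:R - 1 != 0 :> F by rewrite subr_eq0 (eqr_nat _ m 1) gtn_eqF.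
rewrite (_ : (m - w = N)%N); last by rewrite -cW addKn.
under eq_bigr => j _.
  rewrite /clique_mult (_ : (m - (w + j) = N - j)%N); last by rewrite -cW subnDl.
  rewrite natrD (_ : 'C(N, j)%:R * _ = ((w%:R - 1) / (m%:R - 1)) *
     ('C(N, j)%:R * (m%:R - 1) ^+ (N - j)) +
     (m%:R - 1)^-1 * ('C(N, j)%:R * (j%:R * (m%:R - 1) ^+ (N - j)))); last by ring.
  over.
rewrite big_split /= -!mulr_sumr sum_bin sum_bin_mom1 subrK.
have wE : w%:R = m%:R - N%:R :> F by rewrite -cW natrD addrK.
rewrite wE; case: N {cW wE} => [|N] /=; first by rewrite expr0; field; rewrite m0 a0.
by rewrite !exprS; field; rewrite m0 a0.
Qed.

(** * Walks in cliques and the trace formula *)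

(** These are the entries of (J - I)^k on U, with J the all-ones matrix; induction on the first
    step. *)
Lemma card_clique_walks (F : numFieldType) m (U : {set 'I_m}) k x z :
  x \in U -> z \in U ->
  \sum_(s <- words 'I_m k | [&& neqpath x s, last x s == z & all (mem U) s]) 1 =
    ((#|U|%:R - 1) ^+ k - (-1) ^+ k) / #|U|%:R + (x == z)%:R * (-1) ^+ k :> F.
Proof.
move=> xU zU; have u0 : #|U|%:R != 0 :> F.
  by rewrite pnatr_eq0 -lt0n; apply/card_gt0P; exists x.
elim: k x xU => [|k IHk] x xU.
  rewrite big_mkcond big_cons big_nil /= andbT addr0 !expr0 subrr mul0r add0r mulr1.
  by case: eqP.
rewrite big_words /=.
transitivity (\sum_(y in U :\ x)
   (((#|U|%:R - 1) ^+ k - (-1) ^+ k) / #|U|%:R + (y == z)%:R * (-1) ^+ k : F)).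
  rewrite [RHS]big_mkcond; apply: eq_bigr => y _; rewrite !inE.
  case: ifP => [/andP[nyx yU]|nyx]; last first.
    rewrite big_pred0 // => s; move: nyx.
    by case: (y != x); case: (y \in U) => //=; rewrite !andbF.
  by rewrite -IHk //; apply: eq_bigl => s; rewrite nyx yU.
rewrite big_split /= sumr_const -mulr_suml -[_ *+ _]mulr_natl.
have -> : \sum_(y in U :\ x) (y == z)%:R = 1 - (x == z)%:R :> F.
  have [->|nxz] := eqVneq x z.
    by rewrite subrr big1 // => y; rewrite !inE => /andP[/negPf-> _].
  rewrite (bigD1 z) /=; last by rewrite !inE eq_sym nxz.
  by rewrite eqxx big1 ?addr0 ?subr0 // => y /andP[_ /negPf->].
have -> : #|U :\ x|%:R = #|U|%:R - 1 :> F.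
  by rewrite [in RHS](cardsD1 x) xU natrD addrAC subrr add0r.
by rewrite !exprS; field.
Qed.

Lemma card_closed_clique_walks (F : numFieldType) m (U : {set 'I_m}) k :
  (0 < k)%N ->
  \sum_x \sum_(s <- words 'I_m k |
                [&& neqpath x s, last x s == x & all (mem U) s]) 1 =
    (#|U|%:R - 1) ^+ k + (#|U|%:R - 1) * (-1) ^+ k :> F.
Proof.
(* Since k > 0, the endpoint x occurs in [s], so x lies in U. *)
case: k => // k _; rewrite (bigID (mem U)) /= [X in _ + X]big1 ?addr0; last first.
  move=> x nxU; rewrite big_words big1 // => y _; rewrite big_pred0 // => s.
  apply/and3P=> -[_ /eqP lx /allP aU]; case/negP: nxU.
  by have := aU _ (mem_last y s); rewrite -[last y s]/(last x (y :: s)) lx.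
under eq_bigr => x xU do rewrite (card_clique_walks F k.+1 xU xU) eqxx mul1r.
rewrite sumr_const -[LHS]mulr_natl.
have [->|u0] := eqVneq #|U| 0%N; first by rewrite mulr0n mul0r sub0r exprS; ring.
by field; rewrite pnatr_eq0.
Qed.

(** Write the weight of a closed walk as a sum over U containing its vertices, then exchange the
    sums: each U collects the closed walks inside it. *)
Lemma trace_unicycle_adj_cliques (F : numFieldType) m k : (2 <= m)%N -> (0 < k)%N ->
  \tr (unicycle_adj F m ^+ k) =
    \sum_(j < m.+1) 'C(m, j)%:R * (clique_mult F m j *
      ((j%:R - 1) ^+ k + (j%:R - 1) * (-1) ^+ k)).
Proof.
move=> m_ge2 k_gt0; pose G j : F := clique_mult F m j *
  ((j%:R - 1) ^+ k + (j%:R - 1) * (-1) ^+ k).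
have -> : \sum_(j < m.+1) 'C(m, j)%:R * G j =
    \sum_(U : {set 'I_m} | set0 \subset U) G #|U|.
  rewrite sum_supersets cards0.
  by have -> : #|~: (set0 : {set 'I_m})| = m by rewrite setC0 cardsT card_ord.
rewrite (eq_bigl xpredT) => [|U]; last by rewrite sub0set.
under [RHS]eq_bigr => U _.
  rewrite /G -card_closed_clique_walks // mulr_sumr.
  over.
rewrite exchange_big trace_unicycle_adj; apply: eq_bigr => x _ /=.
under [RHS]eq_bigr => U _.
  rewrite mulr_sumr.
  rewrite (eq_bigl (fun s => (neqpath x s && (last x s == x)) && all (mem U) s));
    last by move=> s; rewrite andbA.
  rewrite big_mkcondr; over.
rewrite exchange_big /= big_seq_cond [RHS]big_seq_cond; apply: eq_bigr => s.
case/andP=> /size_words sz /andP[ps /eqP ls].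
rewrite card_drive_fixed ?sz // -sum_clique_mult // big_mkcond /=.
apply: eq_bigr => U _; rewrite mulr1.
suff -> : ([set v in s] \subset U) = all (mem U) s by [].
apply/subsetP/allP => H v; first by move=> vs; apply: H; rewrite inE.
by rewrite inE; apply: H.
Qed.

(* The j = 0 term vanishes: it is a multiple of p.[-1] - p.[-1].              *)
Lemma sum_poly_eigenvalues (F : numFieldType) m (I : finType) (d : I -> F)
    (p : {poly F}) :
  (2 <= m)%N ->
  (forall k, \tr (unicycle_adj F m ^+ k) = \sum_i d i ^+ k) ->
  \sum_i p.[d i] = m%:R ^+ m.-1 * (m%:R - 2) * p.[0] +
    \sum_(j < m.+1) 'C(m, j)%:R * (clique_mult F m j *
      (p.[j%:R - 1] + (j%:R - 1) * p.[-1])).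
Proof.
move=> m_ge2 trd.
have a0 : m%:R - 1 != 0 :> F by rewrite subr_eq0 (eqr_nat _ m 1) gtn_eqF.
(* The term with 0^k matters only at k = 0: there are m^(m-1) (m-1) states, and the cliques account
   for m^(m-1) of them. *)
have dk k : \sum_i d i ^+ k = m%:R ^+ m.-1 * (m%:R - 2) * 0 ^+ k +
    \sum_(j < m.+1) 'C(m, j)%:R * (clique_mult F m j *
      ((j%:R - 1) ^+ k + (j%:R - 1) * (-1) ^+ k)).
  rewrite -trd; have [->|k_gt0] := posnP k; last first.
    by rewrite expr0n gtn_eqF // mulr0 add0r trace_unicycle_adj_cliques.
  rewrite expr0 mxtrace1 card_unicycles ?(ltnW m_ge2) //.
  under eq_bigr => j _ do rewrite !expr0 mulr1 addrC subrK /clique_mult.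
  under eq_bigr => j _.
    rewrite (_ : 'C(m, j)%:R * _ = (m%:R - 1)^-1 *
      ('C(m, j)%:R * (j%:R * ((j%:R - 1) * (m%:R - 1) ^+ (m - j)))));
      last by ring.
    over.
  rewrite -mulr_sumr; case: m m_ge2 a0 {trd} => [|[|N]] // _ a0.
  rewrite sum_bin_mom2 subrK /= exprS.
  have NE : N.+2%:R = N.+1%:R + 1 :> F by rewrite natr1.
  rewrite NE in a0 *; rewrite addrK in a0.
  by move: (N.+1%:R : F) a0 => x a0; field; rewrite addrK.
under eq_bigr => i _ do rewrite horner_coef.
rewrite exchange_big /=.
under eq_bigr => k _ do rewrite -mulr_sumr dk mulrDr.
rewrite big_split /=; congr (_ + _).
  by rewrite horner_coef mulr_sumr; apply: eq_bigr => k _; ring.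
under eq_bigr => k _ do rewrite mulr_sumr.
rewrite exchange_big /=; apply: eq_bigr => j _.
rewrite !horner_coef [in RHS]mulr_sumr -big_split /= !mulr_sumr.
by apply: eq_bigr => k _; ring.
Qed.

(** * Multiplicities from power sums *)

Lemma eigenvalue_count (F : numFieldType) m (I : finType) (d : I -> F) z :
  (2 <= m)%N ->
  (forall k, \tr (unicycle_adj F m ^+ k) = \sum_i d i ^+ k) ->
  #|[pred i | d i == z]|%:R = m%:R ^+ m.-1 * (m%:R - 2) * (0 == z)%:R +
    \sum_(j < m.+1) 'C(m, j)%:R * (clique_mult F m j *
      ((j%:R - 1 == z)%:R + (j%:R - 1) * (-1 == z)%:R)).
Proof.
move=> m_ge2 trd.
(* All points where either side evaluates the polynomial, so that it acts as the indicator of z on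
   both. *)
pose s := [:: 0, -1 & codom d ++ codom (fun j : 'I_m.+1 => j%:R - 1 : F)].
have [p ps] := interpolate_indicator s z.
have := sum_poly_eigenvalues p m_ge2 trd; rewrite !ps ?inE ?eqxx ?orbT //.
under eq_bigr => i _ do rewrite ps ?inE ?mem_cat ?codom_f ?orbT //.
rewrite -natr_sum (_ : (\sum_i _ = #|[pred i | d i == z]|)%N) => [->|]; last first.
  rewrite -sum1_card [RHS]big_mkcond; apply: eq_bigr => i _.
  by rewrite inE /=; case: (d i == z).
congr (_ + _); apply: eq_bigr => j _.
by rewrite ps // !inE mem_cat (codom_f (fun j : 'I_m.+1 => j%:R - 1 : F)) !orbT.
Qed.

(** The sum of C(m,j) c(j) (j-1) is m^(m-1), by expanding (j-1)^2 as j(j-1) - j + 1; the indicator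
    of j-1 = -1 adds c(0) = -(m-1)^(m-1). *)
Lemma eigenvalue_count_neg1 (F : numFieldType) m (I : finType) (d : I -> F) :
  (2 <= m)%N ->
  (forall k, \tr (unicycle_adj F m ^+ k) = \sum_i d i ^+ k) ->
  #|[pred i | d i == -1]|%:R = m%:R ^+ m.-1 - (m%:R - 1) ^+ m.-1 :> F.
Proof.
move=> m_ge2 trd; rewrite (eigenvalue_count _ m_ge2 trd).
have a0 : m%:R - 1 != 0 :> F by rewrite subr_eq0 (eqr_nat _ m 1) gtn_eqF.
rewrite eqxx eq_sym oppr_eq0 oner_eq0 mulr0 add0r.
under eq_bigr => j _ do rewrite mulr1 mulrDr mulrDr.
rewrite big_split /= addrC; congr (_ + _); last first.
  rewrite (bigD1 ord0) //= big1 => [|j j0]; last first.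
    rewrite -subr_eq0 opprK subrK pnatr_eq0 (negPf (_ : (j : nat) != 0%N)) //.
    by rewrite !mulr0.
  rewrite addr0 bin0 mul1r sub0r eqxx mulr1 /clique_mult subn0 sub0r mulN1r.
  rewrite (_ : (m%:R - 1) ^+ m = (m%:R - 1) ^+ m.-1 * (m%:R - 1)).
    by rewrite mulNr mulfK.
  by rewrite -exprSr prednK // ltnW.
under eq_bigr => j _.
  rewrite /clique_mult (_ : 'C(m, j)%:R * _ = (m%:R - 1)^-1 *
    ('C(m, j)%:R * (j%:R * ((j%:R - 1) * (m%:R - 1) ^+ (m - j)))
    - 'C(m, j)%:R * (j%:R * (m%:R - 1) ^+ (m - j))
    + 'C(m, j)%:R * (m%:R - 1) ^+ (m - j))); last by ring.
  over.
rewrite -mulr_sumr big_split sumrB /= sum_bin sum_bin_mom1.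
case: m m_ge2 a0 {trd} => [|[|N]] // _ a0.
rewrite sum_bin_mom2 subrK /=.
have NE : N.+2%:R = N.+1%:R + 1 :> F by rewrite natr1.
rewrite NE in a0 *; rewrite addrK in a0.
rewrite -exprS.
by move: (N.+1%:R : F) a0 => x a0; rewrite !exprS; field; rewrite addrK.
Qed.

Lemma eigenvalue_count_nat (F : numFieldType) m (I : finType) (d : I -> F) n :
  (2 <= m)%N -> (n < m)%N ->
  (forall k, \tr (unicycle_adj F m ^+ k) = \sum_i d i ^+ k) ->
  #|[pred i | d i == n%:R]|%:R =
    m%:R ^+ m.-1 * (m%:R - 2) * (n == 0)%:R +
    n%:R * 'C(m, n.+1)%:R * (m%:R - 1) ^+ (m - n.+1) / (m%:R - 1) :> F.
Proof.
move=> m_ge2 ltnm trd; rewrite (eigenvalue_count _ m_ge2 trd).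
rewrite eq_sym pnatr_eq0; congr (_ + _).
have lt1 : (n.+1 < m.+1)%N by [].
have m1n : -1 == n%:R :> F = false by rewrite eq_sym -addr_eq0 natr1 pnatr_eq0.
(* Only cliques of size n+1 have the eigenvalue n. *)
rewrite (bigD1 (Ordinal lt1)) //= big1 => [|j nj].
  by rewrite m1n mulr0 !addr0 /clique_mult -natr1 addrK eqxx mulr1; ring.
rewrite m1n mulr0 addr0 subr_eq natr1 eqr_nat.
by rewrite (negPf (_ : (j : nat) != n.+1)) // !mulr0.
Qed.

Theorem proposition4p1 (C : numClosedFieldType) (m : nat) (hm : (2 <= m)%N) :
  (forall lambda : C, eigenvalue (unicycle_laplacian C m) lambda ->
     exists2 k : nat, (k <= m)%N & lambda = k%:R) /\
  (forall i : int, -1 <= i <= m%:Z - 1 ->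
     (alg_mult (unicycle_laplacian C m) (m%:Z - 1 - i)%:~R)%:R =
       (if i == -1 then m%:R ^+ (m - 1) - (m%:R - 1) ^+ (m - 1)
        else if i == 0 then m%:R ^+ (m - 1) * (m%:R - 2)
        else i%:~R * 'C(m, `|(i + 1)%R|%N)%:R * (m%:R - 1) ^ (m%:Z - i - 2))
       :> rat).
Proof.
have m_gt0 := ltnW hm.
have [d [trd multE]] := spectrum_mx (unicycle_adj C m).
have predE : m.-1%:R = m%:R - 1 :> C.
  by rewrite -[in RHS](prednK m_gt0) -natr1 addrK.
have {}multE x : alg_mult (unicycle_laplacian C m) x =
    #|[pred i | d i == m%:R - 1 - x]|.
  rewrite /alg_mult unicycle_laplacianE multE predE; apply: eq_card => i.
  by rewrite !inE [RHS]eq_sym !subr_eq [x + _]addrC.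
split=> [lambda|i /andP[i_ge i_le]].
  rewrite -[eigenvalue _ _]negbK -alg_mult_eq0 multE -(pnatr_eq0 C).
  rewrite (eigenvalue_count _ hm trd).
  (* The candidates 0, -1 and j-1 for A correspond to m-1, m and m-j for L, all naturals at most m;
     for any other lambda every term of the count vanishes. *)
  have [/existsP[k /eqP-> _]|] := boolP [exists k : 'I_m.+1, lambda == k%:R].
    by exists k; rewrite // -ltnS.
  rewrite negb_exists => /forallP nlam.
  have {}nlam k : (k <= m)%N -> lambda == k%:R = false.
    by rewrite -ltnS => lt_k; apply/negbTE/(nlam (Ordinal lt_k)).
  have zE c : (c == m%:R - 1 - lambda) = (lambda == m%:R - 1 - c).
    by rewrite [LHS]eq_sym [RHS]eq_sym !subr_eq [lambda + _]addrC.
  rewrite zE subr0 -predE nlam ?leq_pred // mulr0 add0r predE.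
  rewrite big1 ?eqxx // => j _; rewrite !zE opprK subrK nlam // mulr0 addr0.
  have -> : m%:R - 1 - (j%:R - 1) = (m - j)%:R :> C.
    by rewrite natrB; [ring | rewrite -ltnS].
  by rewrite nlam ?leq_subr // !mulr0.
(* The count holds in C; the rational identity follows by injectivity of [ratr]. *)
rewrite multE; apply: (fmorph_inj (ratr : {rmorphism rat -> C})).
have -> : m%:R - 1 - (m%:Z - 1 - i)%:~R = i%:~R :> C by rewrite !rmorphB /=; ring.
rewrite rmorph_nat; case: i i_ge i_le => [n|[|n]] // _ i_le; last first.
  rewrite (eigenvalue_count_neg1 hm trd) eqxx subn1.
  by rewrite rmorphB !rmorphXn rmorphB rmorph1 rmorph_nat.
have ltnm : (n < m)%N.
  by move: i_le; rewrite lerBrDr lez_nat addn1.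
rewrite (eigenvalue_count_nat hm ltnm trd) subn1 /=.
case: n i_le ltnm => [|n] _ ltnm /=.
  by rewrite mulr1 !mul0r addr0 rmorphM rmorphXn rmorphB !rmorph_nat.
rewrite mulr0 add0r !rmorphM !rmorph_nat /= addn1 -[LHS]mulrA.
have a0 : m%:R - 1 != 0 :> rat by rewrite subr_eq0 (eqr_nat _ m 1) gtn_eqF.
congr (_ * _).
(* The integer exponent is -1 when i = m-1; splitting off one inverse factor matches the division in
   [eigenvalue_count_nat]. *)
have -> : m%:Z - n.+1%:Z - 2 = (m - n.+2)%N%:Z - 1 by rewrite -subzn //; ring.
by rewrite expfzDr // -exprnP exprN1 rmorphM fmorphV
   rmorphXn rmorphB rmorph1 rmorph_nat.
Qed.
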